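(* Let $r=r(n)$ be a function of $n$ taking integer values $r(n)\ge2$ and satisfying $r(n)=o\!\left(\frac{\ln n}{\ln\ln n}\right)$ as $n\to\infty$. Then there exist a constant $c>0$ and $n_0$ such that for every $n\ge n_0$ the following holds: every $n$-uniform hypergraph whose maximum edge degree $D$ satisfies $$D< c\left(\frac{n}{\ln n}\right)^{\frac{r-1}{r}} r^{\,n-1}\qquad(r=r(n))$$ has chromatic number at most $r$.
   Context: A hypergraph $H=(V,E)$ consists of a finite vertex set $V$ and a family $E$ of subsets of $V$ (edges); it is $n$-uniform if every edge has exactly $n$ vertices. A coloring is proper if no edge is monochromatic; the chromatic number is the least number of colors in a proper coloring. The edge degree of an edge $A$ is the number of other edges $B\neq A$ with $A\cap B\neq\emptyset$; the maximum edge degree $D$ is the maximum of this over all edges. *)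

(* Defs.v *)
From mathcomp Require Import all_boot.
From Stdlib Require Import Reals.
Set Implicit Arguments. Unset Strict Implicit. Unset Printing Implicit Defensive.

(* A hypergraph on a finite vertex type V is given by its set of edges E. *)

Definition uniform (V : finType) (n : nat) (E : {set {set V}}) : bool :=
  [forall A in E, #|A| == n].

Definition edge_degree (V : finType) (E : {set {set V}}) (A : {set V}) : nat :=
  #|[set B in E | (B != A) && (A :&: B != set0)]|.

(* maximum edge degree (0 for the empty hypergraph). *)
Definition max_edge_degree (V : finType) (E : {set {set V}}) : nat :=
  \max_(A in E) edge_degree E A.

Definition monochromatic (V : finType) (k : nat) (f : V -> 'I_k) (A : {set V}) : bool :=
  [exists i : 'I_k, [forall x in A, f x == i]].

Definition proper_coloring (V : finType) (k : nat) (E : {set {set V}}) (f : V -> 'I_k) : Prop :=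
  forall A, A \in E -> ~~ monochromatic f A.

Definition chromatic_number_le (V : finType) (E : {set {set V}}) (k : nat) : Prop :=
  exists f : V -> 'I_k, proper_coloring E f.

Definition little_o_lnlnln (r : nat -> nat) : Prop :=
  forall eps : R, (0 < eps)%R ->
    exists N : nat, forall n : nat, (N <= n)%N ->
      (INR (r n) <= eps * (ln (INR n) / ln (ln (INR n))))%R.

(* Main.v *)
Require Import Defs.
From mathcomp Require Import all_boot.
From Stdlib Require Import Reals.
From Stdlib Require Import Lra Lia.
Set Implicit Arguments. Unset Strict Implicit. Unset Printing Implicit Defensive.

(** Give each vertex an independent uniform weight among [N = r n] values and, as
    in Pluhar's criterion, call a sequence of edges an ordered chain if the last
    vertex of each is the first vertex of the next. If there is no ordered chain
    of [r] edges, then colouring every vertex by the length of the longest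
    ordered chain starting from it is proper.

    Call an edge short if its weights spread over less than [L = n - d], with [d]
    about [3 ln n]; it is short with probability at most [N (L / N) ^ n]. In a
    chain of [r] long edges consecutive linking vertices are at least [L] apart,
    so their weights are determined by [r - 1] sorted offsets in an interval of
    length [r d]; given these weights, AM-GM bounds the probability of the chain
    by about [r ^ (- r (n - 2))]. The local lemma avoids all short edges and
    all chains of [r] long edges simultaneously. *)

(** * Logarithmic estimates for large [n] *)

Section LogarithmicEstimates.
Local Open Scope R_scope.

Lemma exp_pow_INR (x : R) (n : nat) : exp x ^ n = exp (INR n * x).
Proof.
elim: n => [|n IHn]; first by rewrite /= Rmult_0_l exp_0.
by rewrite S_INR /= IHn -exp_plus; f_equal; ring.
Qed.

Lemma one_add_inv_pow_le3 (n : nat) : 0 < INR n -> (1 + / INR n) ^ n <= 3.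
Proof.
move=> n0; apply: Rle_trans exp_le_3.
have -> : exp 1 = exp (/ INR n) ^ n by rewrite exp_pow_INR Rinv_r //; lra.
have := Rinv_0_lt_compat _ n0 => i0.
by apply: pow_incr; split; [lra | exact: exp_ineq1_le].
Qed.

Lemma exp_le (x y : R) : x <= y -> exp x <= exp y.
Proof. by case=> [/exp_increasing|->]; lra. Qed.

Lemma ln_le (x y : R) : 0 < x -> x <= y -> ln x <= ln y.
Proof. by move=> x0 [/(ln_increasing _ _ x0)|->]; lra. Qed.

(** By $1 - x \le e^{-x}$ the left side is at most $e^{-d}$. The exponent 3 will absorb three
    factors of size at most [n] in the bound for short edges. *)
Lemma one_sub_pow_le (n d : nat) : (d <= n)%coq_nat -> 1 <= INR n ->
  3 * ln (INR n) <= INR d -> (INR (n - d) / INR n) ^ n <= (/ INR n) ^ 3.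
Proof.
move=> dn n1 d_large.
have -> : (/ INR n) ^ 3 = exp (- (3 * ln (INR n))).
  rewrite -{1}(exp_ln (INR n)); last lra.
  by rewrite -exp_Ropp exp_pow_INR /=; f_equal; ring.
apply: (Rle_trans _ (exp (- INR d))); last by apply: exp_le; lra.
have -> : exp (- INR d) = exp (- (INR d / INR n)) ^ n.
  by rewrite exp_pow_INR; f_equal; field; lra.
apply: pow_incr; split.
  by apply: Rmult_le_pos; [exact: pos_INR | apply/Rlt_le/Rinv_0_lt_compat; lra].
rewrite minus_INR //; have -> : (INR n - INR d) / INR n = 1 + - (INR d / INR n) by field; lra.
exact: exp_ineq1_le.
Qed.

Lemma ln_ge3 (x : R) : 27 <= x -> 3 <= ln x.
Proof.
move=> x27; rewrite -(ln_exp 3); apply: ln_le; first exact: exp_pos.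
have -> : exp 3 = exp 1 ^ 3 by rewrite exp_pow_INR /=; f_equal; ring.
have := exp_le_3; have := exp_pos 1 => e0 e3.
by have := pow_incr (exp 1) 3 3 (conj (Rlt_le _ _ e0) e3); lra.
Qed.

Lemma ln_le_eighth (x : R) : 0 < x -> ln x <= x / 8 + 2.
Proof.
move=> x0; have -> : ln x = ln (x / 8) + 3 * ln 2.
  have {1}-> : x = (x / 8) * (2 * (2 * 2)) by lra.
  by rewrite !ln_mult; lra.
have h2 : ln 2 <= 1 by have := exp_ineq1_le (ln 2); rewrite exp_ln; lra.
have := exp_ineq1_le (ln (x / 8)); rewrite exp_ln; lra.
Qed.

(** With [eps = 1] the growth hypothesis gives $r \le \ln n / \ln\ln n$, and $\ln\ln n \ge 1$ once
    $n \ge 27$, because $\ln n \ge 3 \ge e$. *)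
Lemma little_o_le (r : nat -> nat) : little_o_lnlnln r ->
  exists n0 : nat, forall n : nat, leq n0 n -> INR (r n) <= INR n.
Proof.
move=> /(_ 1 Rlt_0_1)[n1 hn1]; exists (maxn n1 27) => n; rewrite geq_max => /andP[n1n n27].
apply: Rle_trans (hn1 n n1n) _.
have x27 : 27 <= INR n by have := le_INR _ _ (elimT leP n27); rewrite (INR_IZR_INZ 27).
have l3 := ln_ge3 x27.
have ll1 : 1 <= ln (ln (INR n)).
  rewrite -(ln_exp 1); apply: ln_le; first exact: exp_pos.
  by have := exp_le_3; lra.
have lnn : ln (INR n) <= INR n by have := exp_ineq1_le (ln (INR n)); rewrite exp_ln; lra.
rewrite Rmult_1_l; apply: Rle_trans lnn.
apply: (Rmult_le_reg_r (ln (ln (INR n)))); first lra.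
have -> : ln (INR n) / ln (ln (INR n)) * ln (ln (INR n)) = ln (INR n) by field; lra.
by have := Rmult_le_compat_l (ln (INR n)) 1 (ln (ln (INR n))); lra.
Qed.

(** Trades the fractional exponent $(r-1)/r$, with [q] standing for $r - 1$, for an identity between
    integer powers, usable in any ordered field. *)
Lemma Rpower_frac_pow (X : R) (q : nat) : 0 < X ->
  Rpower X ((INR q.+1 - 1) / INR q.+1) ^ q.+1 = X ^ q.
Proof.
move=> X0; rewrite -Rpower_pow; last exact: exp_pos.
rewrite Rpower_mult -Rpower_pow //; f_equal.
have : 0 < INR q.+1 by apply: lt_0_INR; lia.
by rewrite S_INR => q1; field; lra.
Qed.

Lemma Rpower_frac_bounds (X : R) (q : nat) : 1 <= X ->
  1 <= Rpower X ((INR q.+1 - 1) / INR q.+1) <= X.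
Proof.
move=> X1; have q0 := pos_INR q.
have : 0 < INR q.+1 by apply: lt_0_INR; lia.
rewrite S_INR => q1; have i0 := Rinv_0_lt_compat _ q1.
have -> : (INR q + 1 - 1) / (INR q + 1) = INR q * / (INR q + 1) by field; lra.
split.
  rewrite -{1}(Rpower_O X); last lra.
  by apply: Rle_Rpower => //; apply: Rmult_le_pos; lra.
rewrite -{2}(Rpower_1 X); last lra.
apply: Rle_Rpower => //.
have := Rmult_le_compat_r (/ (INR q + 1)) (INR q) (INR q + 1).
by rewrite Rinv_r; lra.
Qed.

Lemma exists_nat_ceiling (x : R) : 0 < x -> exists d : nat, x <= INR d <= x + 1.
Proof.
move=> x0; have [up1 up2] := archimed x.
have up0 : (0 <= up x)%Z by apply: le_IZR; lra.
by have [d up_d] := IZN _ up0; exists d; rewrite INR_IZR_INZ -up_d; lra.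
Qed.


(** Collects the analysis: $X = n/\ln n$, $Y = X^{(r-1)/r}$ and an integer [d] just above $3 \ln n$
    satisfy algebraic inequalities, and logarithms do not occur afterwards. The 5 comes from $X(d+1)
    \le X(3\ln n + 2) = 3n + 2X$. *)
Lemma large_n_estimates (n q D : nat) : leq 27 n -> leq 1 q ->
  INR D < / 4096 * Rpower (INR n / ln (INR n)) ((INR q.+1 - 1) / INR q.+1)
            * INR q.+1 ^ (n - 1) ->
  exists (d : nat) (X Y : R),
    leq 1 d /\ leq d.+1 n /\ 0 <= Y /\ Y <= X /\ X <= INR n /\
    Y ^ q.+1 = X ^ q /\
    (INR (n - d) / INR n) ^ n <= (/ INR n) ^ 3 /\
    (1 + / INR n) ^ n <= 3 /\
    X * INR d.+1 <= 5 * INR n /\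
    INR D.+1 <= 2 * / 4096 * Y * INR q.+1 ^ (n - 1).
Proof.
move=> n27 q0 D_lt.
have x27 : 27 <= INR n by have := le_INR _ _ (elimT leP n27); rewrite (INR_IZR_INZ 27).
have l3 := ln_ge3 x27.
have l8 : ln (INR n) <= INR n / 8 + 2 by apply: ln_le_eighth; lra.
have [d [d_large d_small]] : exists d : nat, 3 * ln (INR n) <= INR d <= 3 * ln (INR n) + 1.
  by apply: exists_nat_ceiling; lra.
move: D_lt; set X := INR n / ln (INR n) => D_lt.
have Xln : X * ln (INR n) = INR n by rewrite /X; field; lra.
have X1 : 1 <= X by nra.
have Xn : X <= INR n by nra.
have [Y1 YX] := Rpower_frac_bounds q X1.
have X0 : 0 < X by lra.
have YrXq := Rpower_frac_pow q X0.
set Y := Rpower _ _ in D_lt Y1 YX YrXq.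
have dn : leq d.+1 n by apply/ltP/INR_lt; lra.
have n1 : 1 <= INR n by lra.
(* Hence $1 \le Y r^{n-1}/4096$, so passing from [D] to [D.+1] only doubles the bound. *)
have large : 4096 <= INR q.+1 ^ (n - 1).
  have r2 : 2 <= INR q.+1.
    by rewrite S_INR; have := le_INR _ _ (elimT leP q0); rewrite (INR_IZR_INZ 1) /=; lra.
  apply: (Rle_trans _ (2 ^ 12)); first by lra.
  apply: (Rle_trans _ (2 ^ (n - 1))); last by apply: pow_incr; lra.
  by apply: Rle_pow; [lra | apply/leP; rewrite leq_subRL // (leq_trans _ n27)].
exists d, X, Y; split; first by apply/ltP/INR_lt; rewrite (INR_IZR_INZ 0) /=; lra.
do 4![split; [by lra || by []|]]; split=> //; split.
  exact: one_sub_pow_le (elimT leP (ltnW dn)) n1 d_large.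
split; first by apply: one_add_inv_pow_le3; lra.
by split; rewrite S_INR; nra.
Qed.

End LogarithmicEstimates.

From mathcomp Require Import all_boot all_order all_algebra ring lra zify.
From mathcomp Require Import Rstruct.
Import Order.TTheory GRing.Theory Num.Theory.
Delimit Scope ring_scope with R.
Delimit Scope nat_scope with N.

Open Scope ring_scope.

(** * Local lemma on product spaces *)

Lemma ler_sum_subpred (R : numDomainType) (I : finType) (P Q : pred I)
    (F : I -> R) :
  (forall i, P i -> Q i) -> (forall i, Q i -> 0 <= F i) ->
  \sum_(i | P i) F i <= \sum_(i | Q i) F i.
Proof.
move=> sPQ F0; rewrite [leLHS]big_mkcond [leRHS]big_mkcond /=.
apply: ler_sum => i _; case: ifPn => [Pi|_]; first by rewrite sPQ.
by case: ifP => // /F0.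
Qed.

Section Probability.
Variables (R : realFieldType) (T : finType).
Implicit Types X Y : {set T}.

Definition pr (X : {set T}) : R := #|X|%:R / #|T|%:R.

Lemma pr_ge0 X : 0 <= pr X.
Proof. by rewrite divr_ge0. Qed.

Lemma pr0 : pr set0 = 0.
Proof. by rewrite /pr cards0 mul0r. Qed.

Lemma pr_sub X Y : X \subset Y -> pr X <= pr Y.
Proof.
by move=> sXY; rewrite ler_wpM2r ?invr_ge0 // ler_nat subset_leq_card.
Qed.

Lemma prID X Y : pr X = pr (X :&: Y) + pr (X :\: Y).
Proof. by rewrite /pr -mulrDl -natrD cardsID. Qed.

Lemma pr_bigcup (I : finType) (P : pred I) (F : I -> {set T}) :
  pr (\bigcup_(i | P i) F i) <= \sum_(i | P i) pr (F i).
Proof.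
elim/big_rec2: _ => [|i y X _ leXy]; first by rewrite pr0.
apply: le_trans (lerD (lexx _) leXy).
rewrite /pr -mulrDl -natrD ler_wpM2r ?invr_ge0 // ler_nat.
exact: leq_card_setU.
Qed.

End Probability.

(** * Local lemma with a bound on sums over neighbours *)

Section LocalLemma.
Variables (R : realFieldType) (T J : finType) (B : J -> {set T}) (nbr : rel J).
Local Notation pr := (@pr R T).

Definition avoid (K : {set J}) : {set T} := \bigcap_(j in K) ~: B j.

Lemma avoidU1 i K : avoid (i |: K) = avoid K :\: B i.
Proof. by rewrite /avoid bigcap_setU big_set1 setDE setIC. Qed.

Lemma avoidU K1 K2 : avoid (K1 :|: K2) = avoid K1 :&: avoid K2.
Proof. by rewrite /avoid bigcap_setU. Qed.

Hypothesis indep : forall i (K : {set J}), (forall j, j \in K -> ~~ nbr i j) ->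
  pr (B i :&: avoid K) = pr (B i) * pr (avoid K).
Hypothesis sum_nbr : forall i, \sum_(j | nbr i j) pr (B j) <= 4^-1.
Hypothesis pr_event : forall i, pr (B i) <= 4^-1.

(** The conditional bound $P(B_i \mid \mathrm{avoid}\,K) \le 2 P(B_i)$, multiplied out to avoid
    division, by induction on $|K|$. Split [K] into neighbours [K1] and the rest [K2]: forgetting
    [K1] bounds the left side by independence, and the events of [K1] remove at most $2 \cdot 1/4$
    of [avoid K2]. *)
Lemma pr_event_avoid i (K : {set J}) :
  pr (B i :&: avoid K) <= 2 * pr (B i) * pr (avoid K).
Proof.
move: {2}#|K| (leqnn #|K|) i => m.
elim: m K => [|m IHm] K leKm i.
  have -> : K = set0 by apply/eqP; rewrite -cards_eq0 -leqn0.
  rewrite indep; last by move=> j; rewrite inE.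
  have := mulr_ge0 (pr_ge0 R (B i)) (pr_ge0 R (avoid set0)); lra.
pose K1 := [set j in K | nbr i j]; pose K2 := [set j in K | ~~ nbr i j].
have defK : K = K1 :|: K2 by apply/setP => j; rewrite !inE -andb_orr orbN andbT.
have disK : [disjoint K1 & K2].
  rewrite -setI_eq0; apply/eqP/setP => j; rewrite !inE.
  by case: (nbr i j); rewrite ?andbF.
have cardK : (#|K| = #|K1| + #|K2|)%N.
  by rewrite {1}defK cardsU; move: disK; rewrite -setI_eq0 => /eqP ->; rewrite cards0 subn0.
have indep2 : pr (B i :&: avoid K2) = pr (B i) * pr (avoid K2).
  by apply: indep => j; rewrite inE => /andP[].
have up : pr (B i :&: avoid K) <= pr (B i) * pr (avoid K2).
  by rewrite -indep2 pr_sub // setIS // defK avoidU subsetIr.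
have low : 2^-1 * pr (avoid K2) <= pr (avoid K).
  have half : \sum_(j in K1) pr (B j :&: avoid K2) <= 2^-1 * pr (avoid K2).
    apply: (@le_trans _ _ (\sum_(j in K1) 2 * pr (B j) * pr (avoid K2))).
      apply: ler_sum => j jK1; apply: IHm.
      (* A member of [K1] makes [K2] strictly smaller than [K], as the induction hypothesis
         requires. *)
      have : (0 < #|K1|)%N by apply/card_gt0P; exists j.
      lia.
    rewrite -mulr_suml -mulr_sumr ler_wpM2r ?pr_ge0 //.
    have : \sum_(j in K1) pr (B j) <= \sum_(j | nbr i j) pr (B j).
      apply: ler_sum_subpred => [j|j _]; last exact: pr_ge0.
      by rewrite inE => /andP[].
    move/le_trans/(_ (sum_nbr i)); lra.
  have cover : avoid K2 :\: avoid K \subset \bigcup_(j in K1) (B j :&: avoid K2).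
    apply/subsetP => w /setDP[wK2]; rewrite defK avoidU inE wK2 andbT => nwK1.
    have [j jK1 wj] : exists2 j, j \in K1 & w \in B j.
      apply/exists_inP; apply: contraR nwK1; rewrite negb_exists_in => /forall_inP h.
      by apply/bigcapP => j /h; rewrite inE.
    by apply/bigcupP; exists j => //; rewrite inE wj.
  have := prID R (avoid K2) (avoid K).
  have -> : avoid K2 :&: avoid K = avoid K.
    by apply/setIidPr; rewrite defK avoidU subsetIr.
  have := le_trans (pr_sub R cover) (pr_bigcup R _ _).
  lra.
have := pr_ge0 R (B i); nra.
Qed.

(** Excluding one more event costs at most $2 \cdot 1/4$ of the remaining probability, so positivity
    survives up to [avoid setT]. *)
Lemma local_lemma : (0 < #|T|)%N -> exists w, forall j, w \notin B j.
Proof.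
move=> T0.
have pos (K : {set J}) : 0 < pr (avoid K).
  move: {2}#|K| (erefl #|K|) => m; elim: m K => [|m IHm] K.
    move/eqP; rewrite cards_eq0 => /eqP ->.
    by rewrite /avoid big_set0 /pr cardsT divff ?ltr01 // pnatr_eq0 -lt0n.
  move=> cK; have /card_gt0P[i iK] : (0 < #|K|)%N by rewrite cK.
  rewrite -(setD1K iK) avoidU1.
  have {}/IHm h : #|K :\ i| = m by have := cardsD1 i K; rewrite iK cK; lia.
  have := prID R (avoid (K :\ i)) (B i).
  have := pr_event_avoid i (K :\ i); rewrite setIC.
  have := pr_event i; have := pr_ge0 R (B i); nra.
have : avoid setT != set0.
  by apply: contraTneq (pos setT) => ->; rewrite pr0 ltxx.
case/set0Pn => w /bigcapP h; exists w => j.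
by have := h j (in_setT _); rewrite inE.
Qed.

End LocalLemma.

(** * Independence and boxes in a product space *)

Section ProductSpace.
Variables (V W : finType).
Implicit Types (X Y : {set {ffun V -> W}}) (S : {set V}) (f g : {ffun V -> W}).

Definition depends_on S X :=
  forall f g, {in S, f =1 g} -> f \in X -> g \in X.

Lemma depends_on_iff S X f g :
  depends_on S X -> {in S, f =1 g} -> (f \in X) = (g \in X).
Proof.
move=> dX fg; apply/idP/idP; apply: dX => // x xS; by rewrite fg.
Qed.

(* The involution exchanging the coordinates in [S] of two points maps
   [(X :&: Y) * Omega] onto [X * Y]. *)
Lemma card_setI_indep S X Y : depends_on S X -> depends_on (~: S) Y ->
  (#|X :&: Y| * #|{ffun V -> W}| = #|X| * #|Y|)%N.
Proof.
move=> dX dY.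
pose mix (f g : {ffun V -> W}) := [ffun x => if x \in S then f x else g x].
pose h p := (mix p.1 p.2, mix p.2 p.1).
have hK : involutive h.
  by case=> f g; rewrite /h /=; congr (_, _); apply/ffunP => x; rewrite !ffunE; case: (x \in S).
rewrite -cardsT -!cardsX -(card_preimset (setX X Y) (inv_inj hK)).
apply: eq_card => -[f g]; rewrite !inE /= andbT.
have -> : (mix f g \in X) = (f \in X).
  by apply: (depends_on_iff dX) => x xS; rewrite ffunE xS.
congr andb; apply: (depends_on_iff dY) => x; rewrite inE => /negPf xS; by rewrite ffunE xS.
Qed.

Lemma pr_setI_indep (R : realFieldType) S X Y : (0 < #|{ffun V -> W}|)%N ->
  depends_on S X -> depends_on (~: S) Y ->
  pr R (X :&: Y) = pr R X * pr R Y.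
Proof.
move=> O0 dX dY; rewrite /pr mulf_div -!natrM -(card_setI_indep dX dY) !natrM.
by rewrite -mulf_div divff ?mulr1 // pnatr_eq0 -lt0n.
Qed.

Lemma depends_on_avoid (J : finType) (B : J -> {set {ffun V -> W}}) S (K : {set J}) :
  (forall j, j \in K -> depends_on S (B j)) -> depends_on S (avoid B K).
Proof.
move=> dB f g fg /bigcapP fK; apply/bigcapP => j jK.
have := fK j jK; rewrite !inE; apply: contra; apply: dB => // x xS.
by rewrite fg.
Qed.

Lemma pr_family (R : realFieldType) (F : V -> {set W}) :
  pr R [set f : {ffun V -> W} in finfun.family F] =
  \prod_(x : V) (#|F x|%:R / #|W|%:R).
Proof.
rewrite /pr cardsE card_family card_ffun foldrE big_map big_enum /=.
rewrite natrX natr_prod prodf_div prodr_const; congr (_ / _).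
Qed.

End ProductSpace.

Close Scope ring_scope.

(** * Ordered chains *)

Section Walks.
Variables (T : finType) (e : rel T) (D : nat).
Hypothesis e_sym : symmetric e.
Hypothesis e_deg : forall x, #|e x| <= D.

(** The start [x] is left out of each list, so that two walks leaving [x] can be glued around it. *)
Fixpoint walks k x : seq (seq T) :=
  if k is k'.+1 then [seq y :: q | y <- enum (e x), q <- walks k' y]
  else [:: [::]].

Lemma sumn_map_leq (S : Type) (F : S -> nat) (s : seq S) M :
  (forall x, F x <= M) -> sumn (map F s) <= size s * M.
Proof.
by move=> FM; elim: s => //= x s IHs; rewrite mulSn leq_add.
Qed.

Lemma size_walks k x : size (walks k x) <= D ^ k.
Proof.
elim: k x => //= k IHk x; rewrite size_allpairs_dep expnS.
apply: leq_trans (sumn_map_leq _ IHk) _.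
by rewrite leq_mul2r -cardE e_deg orbT.
Qed.

Lemma mem_walks x p : path e x p -> p \in walks (size p) x.
Proof.
elim: p x => //= y p IHp x /andP[exy yp].
by apply/allpairsPdep; exists y, p; rewrite mem_enum IHp.
Qed.

(** Symmetry of [e] lets the part before [x] be read backwards as a walk from [x]. *)
Lemma sorted_split s1 x s2 :
  sorted e (s1 ++ x :: s2) -> path e x (rev s1) && path e x s2.
Proof.
move=> es; have [_ /= ->] := cat_sorted2 es; rewrite andbT.
have : sorted e (rev (rcons s1 x)).
  rewrite rev_sorted; move: es; rewrite -cat_rcons => /cat_sorted2[es _].
  by under eq_sorted do rewrite e_sym.
by rewrite rev_rcons.
Qed.

(** Such a walk is recovered from a position [k], the vertex of [Q] found there, and the two walks
    leaving it, of [k] and [m - k.+1] steps. *)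
Lemma card_walks_meeting (Q : {set T}) m :
  #|[set c : m.-tuple T | sorted e c && has [in Q] c]| <= m * (#|Q| * D ^ m.-1).
Proof.
set S := [set c | _].
pose around k x := [seq (p, q) | p <- walks k x, q <- walks (m - k.+1) x].
pose thru k := [seq rev pq.1 ++ x :: pq.2 | x <- enum Q, pq <- around k x].
pose all_walks := flatten [seq thru k | k <- iota 0 m].
have size_thru k : k < m -> size (thru k) <= #|Q| * D ^ m.-1.
  move=> km; rewrite size_allpairs_dep cardE; apply: sumn_map_leq => x.
  rewrite size_allpairs (leq_trans (leq_mul (size_walks _ _) (size_walks _ _))) //.
  by rewrite -expnD leq_eqVlt; apply/orP; left; apply/eqP; congr (_ ^ _); lia.
have size_all : size all_walks <= m * (#|Q| * D ^ m.-1).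
  rewrite size_flatten /shape -map_comp -{2}(size_iota 0 m).
  have : {subset iota 0 m <= gtn m} by move=> k; rewrite mem_iota.
  elim: (iota 0 m) => //= k s IHs ks; rewrite mulSn leq_add //.
    by apply: size_thru; apply: ks; rewrite mem_head.
  by apply: IHs => j js; apply: ks; rewrite inE js orbT.
apply: leq_trans size_all; rewrite cardE -(size_map val).
apply: uniq_leq_size; first by rewrite map_inj_uniq ?enum_uniq //; apply: val_inj.
move=> _ /mapP[c + ->]; rewrite mem_enum inE => /andP[ec hasQ].
pose k := find [in Q] c.
have km : k < m by have : k < size c by [rewrite -has_find]; rewrite size_tuple.
rewrite /=; case: (tval c) (size_tuple c) hasQ ec @k km => [|x0 s] sc hasQ ec k km //.
have xQ := nth_find x0 hasQ; rewrite -/k in xQ.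
have defc : x0 :: s = take k (x0 :: s) ++ nth x0 (x0 :: s) k :: drop k.+1 (x0 :: s).
  by rewrite -drop_nth ?cat_take_drop // sc.
set x := nth _ _ _ in defc xQ.
move: ec; rewrite defc => /sorted_split/andP[p1 p2].
apply/flattenP; exists (thru k); first by apply: map_f; rewrite mem_iota.
apply/allpairsPdep; exists x, (rev (take k (x0 :: s)), drop k.+1 (x0 :: s)).
rewrite mem_enum xQ revK; split=> //.
apply/allpairsPdep; exists (rev (take k (x0 :: s))), (drop k.+1 (x0 :: s)).
split=> //; [have := mem_walks p1|have := mem_walks p2].
  by rewrite size_rev size_takel // sc ltnW.
by rewrite size_drop sc.
Qed.

End Walks.

(** * First and last vertices, and the coloring criterion *)

Section Chains.
Variables (V : finType) (N : nat).
Implicit Types (f : {ffun V -> 'I_N}) (A B : {set V}) (E : {set {set V}}) (u v x y : V).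

(* Orders vertices by weight, breaking ties by a fixed enumeration. *)
Definition key f x : nat := f x * #|V| + enum_rank x.

Lemma key_inj f : injective (key f).
Proof.
move=> x y /(congr1 (modn^~ #|V|)); rewrite /key !modnMDl !modn_small //.
by move/val_inj/enum_rank_inj.
Qed.

Lemma key_le f x y : key f x <= key f y -> f x <= f y.
Proof.
rewrite /key leqNgt => le_xy; rewrite leqNgt; apply: contra le_xy => lt_yx.
apply: (@leq_trans ((f y).+1 * #|V|)); last first.
  by rewrite (leq_trans (leq_mul lt_yx (leqnn _))) ?leq_addr.
by rewrite mulSn -addnS addnC leq_add2r.
Qed.

Definition is_first f A u := (u \in A) && [forall x in A, key f u <= key f x].
Definition is_last f A u := (u \in A) && [forall x in A, key f x <= key f u].
Definition link f A B := [exists u, is_last f A u && is_first f B u].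
Definition long L f A := [exists x in A, [exists y in A, f x + L <= f y]].

Lemma is_firstP f A u :
  reflect (u \in A /\ forall x, x \in A -> key f u <= key f x) (is_first f A u).
Proof. by apply: (iffP andP) => -[uA /forall_inP]. Qed.

Lemma is_lastP f A u :
  reflect (u \in A /\ forall x, x \in A -> key f x <= key f u) (is_last f A u).
Proof. by apply: (iffP andP) => -[uA /forall_inP]. Qed.

Lemma longP L f A :
  reflect (exists x y, [/\ x \in A, y \in A & f x + L <= f y]) (long L f A).
Proof.
apply: (iffP exists_inP) => [[x xA /exists_inP[y yA xy]]|[x [y [xA yA xy]]]].
  by exists x, y.
by exists x => //; apply/exists_inP; exists y.
Qed.

(** Keys refine weights, so the first and last vertices of [A] carry its extreme weights. *)
Lemma long_first_last L f A u w :
  long L f A -> is_first f A u -> is_last f A w -> f u + L <= f w.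
Proof.
case/longP=> x [y [xA yA xy]] /is_firstP[_ /(_ x xA)/key_le ux].
by case/is_lastP=> _ /(_ y yA)/key_le; lia.
Qed.

Lemma first_exists f A x : x \in A -> exists u, is_first f A u.
Proof.
move=> xA; case: (@arg_minnP _ x [in A] (key f) xA) => u uA umin.
by exists u; apply/is_firstP.
Qed.

Lemma last_exists f A x : x \in A -> exists u, is_last f A u.
Proof.
move=> xA; case: (@arg_maxnP _ x [in A] (key f) xA) => u uA umax.
by exists u; apply/is_lastP; split=> // y /umax.
Qed.

(** Ordered chains of [k] edges beginning at [u]. The empty chain begins everywhere, so 0 is always
    a candidate color. *)
Fixpoint starts (E : {set {set V}}) f k u :=
  if k is k'.+1 then
    [exists A in E, [exists w, [&& is_first f A u, is_last f A w & starts E f k' w]]]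
  else true.

Lemma starts_chain E f k u : starts E f k u ->
  exists c : seq {set V}, [/\ size c = k, all [in E] c, sorted (link f) c &
    forall A c', c = A :: c' -> is_first f A u].
Proof.
elim: k u => [|k IHk] u /=; first by exists [::].
case/exists_inP=> A AE /existsP[w /and3P[uA wA /IHk[c [sc cE lc first_c]]]].
exists (A :: c); split=> /=; rewrite ?sc ?AE //; last by move=> ? ? [<-].
case: c first_c {sc cE} lc => //= B c /(_ B c erefl) wB ->; rewrite andbT.
by apply/existsP; exists w; rewrite wA.
Qed.

(** If [A] had one color, prepending [A] to a longest chain from its last vertex would give its
    first vertex a longer one. Longness supplies a vertex in each edge. *)
Lemma coloring_of_no_chain E f L r : 0 < L -> 0 < r ->
    (forall A, A \in E -> long L f A) ->
    (forall c : r.-tuple {set V}, all [in E] c -> ~~ sorted (link f) c) ->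
  chromatic_number_le E r.
Proof.
move=> L0 r0 longE no_chain.
pose P u := [pred k : 'I_r | starts E f k u].
have P0 u : P u (Ordinal r0) by [].
pose color u := [arg max_(k > Ordinal r0 | P u k) val k].
exists color => A AE; apply/existsP => -[i /forall_inP col_i].
have longA := longE _ AE.
have [x [_ [xA _ _]]] := longP _ _ _ longA.
have [u first_u] := first_exists f xA; have [w last_w] := last_exists f xA.
have uA : u \in A by case/is_firstP: first_u.
have wA : w \in A by case/is_lastP: last_w.
have : color u = color w by rewrite (eqP (col_i u uA)) (eqP (col_i w wA)).
rewrite {2}/color; case: arg_maxnP => // k start_k _.
rewrite /color; case: arg_maxnP => // j start_j max_j eq_jk.
have start_u : starts E f k.+1 u.
  by apply/exists_inP; exists A => //; apply/existsP; exists w; rewrite first_u last_w.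
(* Colors stop at [r - 1]: below that, maximality at [u] is contradicted; if $k + 1 = r$, the chain
   itself is forbidden. *)
have [ltkr|] := ltnP k.+1 r.
  by have := max_j (Ordinal ltkr) start_u; rewrite eq_jk /= ltnn.
rewrite leq_eqVlt ltnNge ltn_ord orbF => eq_rk.
have [c [sc cE lc _]] := starts_chain start_u.
have sc' : size c == r by rewrite sc eq_sym.
by have := no_chain (Tuple sc') cE; rewrite lc.
Qed.

End Chains.

Open Scope ring_scope.

(** * Probabilities of short edges and of chains of long edges *)

Lemma card_window N a l : (#|[set y : 'I_N | a <= y < a + l]| <= l)%N.
Proof.
rewrite cardE -(size_map val) -[leqRHS](size_iota a).
apply: uniq_leq_size; first by rewrite map_inj_uniq ?enum_uniq //; apply: val_inj.
by move=> _ /mapP[y + ->]; rewrite mem_enum inE mem_iota.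
Qed.

Lemma prodr_le_exp (R : numDomainType) (I : finType) (B : {set I}) (phi : I -> R) w m :
  (forall x, 0 <= phi x) -> {in B, forall x, phi x <= w} -> 0 <= w <= 1 ->
  (m <= #|B|)%N -> \prod_(x in B) phi x <= w ^+ m.
Proof.
move=> phi0 phiw /andP[w0 w1] mB; apply: (@le_trans _ _ (\prod_(x in B) w)).
  by apply: ler_prod => x xB; rewrite phi0 phiw.
by rewrite prodr_const; apply: ler_wiXn2l.
Qed.

(* Beyond the earlier sets, each [a k] with [k < q] contributes [v k], whose factor is at
   most [z], and at least [n - 2] further vertices. *)
Lemma prodr_chain (R : numDomainType) (V : finType) (a : nat -> {set V})
    (v : nat -> V) (q n : nat) (phi : V -> R) (w : nat -> R) (z : R) :
    (forall k, (k <= q)%N -> #|a k| = n) ->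
    (forall k, (k < q)%N -> a k.+1 :&: \bigcup_(i < k.+1) a i \subset [set v k]) ->
    (forall k, (k < q)%N -> v k \in a k :\: \bigcup_(i < k) a i) ->
    (forall x, 0 <= phi x <= 1) ->
    (forall k x, (k <= q)%N -> x \in a k -> phi x <= w k) ->
    (forall k, (k <= q)%N -> 0 <= w k <= 1) ->
    (forall k, (k < q)%N -> phi (v k) <= z) ->
  \prod_x phi x <= z ^+ q * (\prod_(k < q.+1) w k) ^+ (n - 2).
Proof.
move=> card_a capU vU phi01 phi_w w01 phi_v.
pose U k := \bigcup_(i < k) a i.
have phi0 x : 0 <= phi x by case/andP: (phi01 x).
have US k : U k.+1 = U k :|: (a k :\: U k) 
    by rewrite /U big_ord_recr; apply/setP => x; rewrite !inE; case: (x \in _).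
have disU k : [disjoint U k & a k :\: U k].
  by rewrite -setI_eq0; apply/eqP/setP => x; rewrite !inE; case: (x \in U k).
have prodUS k : \prod_(x in U k.+1) phi x =
    \prod_(x in U k) phi x * \prod_(x in a k :\: U k) phi x.
  by rewrite -bigU //; apply: eq_bigl => x; rewrite US !inE.
(* For positive [k], the set [a k] meets the earlier ones at most in the previous link, so at least
   [n - 1] elements are new. *)
have cardD k : (k <= q)%N -> (n.-1 <= #|a k :\: U k|)%N.
  move=> kq; rewrite -(card_a k kq).
  have := cardsID (U k) (a k); case: k kq => [|k] kq.
    by rewrite /U big_ord0 setI0 cards0; lia.
  by have := subset_leq_card (capU k kq); rewrite cards1 -/(U k.+1); lia.
have prodU k : (k <= q)%N ->
    \prod_(x in U k) phi x <= z ^+ k * (\prod_(i < k) w i) ^+ (n - 2).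
  elim: k => [|k IHk] kq.
    by rewrite /U !big_ord0 big_set0 expr0 expr1n mulr1.
  rewrite prodUS big_ord_recr exprSr exprMn mulrACA.
  apply: ler_pM; rewrite ?prodr_ge0 //; first exact/IHk/ltnW.
  rewrite (big_setD1 _ (vU k kq)) /=.
  apply: ler_pM; rewrite ?prodr_ge0 ?phi_v //.
  apply: prodr_le_exp => //; first last.
  - have := cardD k (ltnW kq); rewrite (cardsD1 (v k)) vU //.
    by rewrite -/(U k) add1n; lia.
  - exact/w01/ltnW.
  by move=> x; rewrite !inE => /and3P[_ _ xa]; apply: phi_w; rewrite // ltnW.
have -> : \prod_x phi x = \prod_(x in U q.+1) phi x * \prod_(x in ~: U q.+1) phi x.
  rewrite (bigID [in U q.+1]) /=; congr (_ * _).
  by apply: eq_bigl => x; rewrite inE.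
apply: (@le_trans _ _ (\prod_(x in U q.+1) phi x)).
  rewrite ler_piMr ?prodr_ge0 //.
  exact: prodr_ile1.
(* The last set has no outgoing link; [n - 2] of its new elements are counted, to match the common
   exponent. *)
rewrite prodUS big_ord_recr exprMn mulrA.
apply: ler_pM; rewrite ?prodr_ge0 ?prodU //.
apply: prodr_le_exp => //; first 1 last.
- exact: w01.
- by have := cardD q (leqnn q); lia.
by move=> x; rewrite !inE => /andP[_ xa]; apply: phi_w.
Qed.

Section Events.
Variables (R : realFieldType) (V : finType) (N L : nat).
Implicit Types f : {ffun V -> 'I_N}.

Definition short_event (A : {set V}) : {set {ffun V -> 'I_N}} :=
  [set f | ~~ long L f A].

Definition chain_event (c : seq {set V}) : {set {ffun V -> 'I_N}} :=
  [set f | sorted (link f) c && all (long L f) c].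

Lemma frac_le1 (W : {set 'I_N}) : 0 <= (#|W|%:R / #|'I_N|%:R : R) <= 1.
Proof.
have le : (#|W| <= #|'I_N|)%N by rewrite max_card.
rewrite divr_ge0 //=; have [->|N0] := posnP #|'I_N|; first by rewrite invr0 mulr0.
by rewrite ler_pdivrMr ?ltr0n // mul1r ler_nat.
Qed.

(** Union bound over the smallest weight [t]: all [n] weights fall in the window $[t, t + L)$. *)
Lemma pr_short_event (A : {set V}) n : (0 < n)%N -> #|A| = n -> (L <= N)%N ->
  pr R (short_event A) <= N%:R * (L%:R / N%:R) ^+ n.
Proof.
move=> n0 cardA LN.
pose W (t : 'I_N) x := if x \in A then [set y : 'I_N | t <= y < t + L]%N else setT.
have sub : short_event A \subset
    \bigcup_t [set f : {ffun V -> 'I_N} in finfun.family (W t)].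
  apply/subsetP => f; rewrite inE => shortA.
  have [x xA] : exists x, x \in A by apply/card_gt0P; rewrite cardA.
  have [u first_u] := first_exists f xA; have [uA minu] := is_firstP _ _ _ first_u.
  apply/bigcupP; exists (f u) => //; rewrite inE; apply/familyP => y.
  rewrite /W; case: ifP => // yA; rewrite inE (key_le (minu y yA)) /=.
  by rewrite ltnNge; apply: contra shortA => le; apply/longP; exists u, y.
apply: le_trans (pr_sub R sub) _; apply: le_trans (pr_bigcup R _ _) _.
have -> : N%:R * (L%:R / N%:R) ^+ n = \sum_(t : 'I_N) (L%:R / N%:R : R) ^+ n.
  by rewrite sumr_const card_ord mulr_natl.
apply: ler_sum => t _.
rewrite pr_family (bigID [in A]) /= -[leRHS]mulr1.
have W01 x : 0 <= (#|W t x|%:R / #|'I_N|%:R : R) <= 1 by apply: frac_le1.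
have W0 x : 0 <= #|W t x|%:R / #|'I_N|%:R :> R by case/andP: (W01 x).
apply: ler_pM; rewrite ?prodr_ge0 ?prodr_ile1 //.
apply: prodr_le_exp => //; last by rewrite cardA.
  move=> x xA; rewrite card_ord ler_wpM2r ?invr_ge0 // ler_nat /W xA.
  exact: card_window.
rewrite divr_ge0 //=; have [->|N0] := posnP N; first by rewrite invr0 mulr0.
by rewrite ler_pdivrMr ?ltr0n // mul1r ler_nat.
Qed.

Section ChainStructure.
Variables (q : nat) (a : nat -> {set V}) (v : nat -> V).
Hypothesis L0 : (0 < L)%N.

(** The links are given by a fixed [v] independent of [f], so that the same vertices serve for all
    weightings in a chain event. *)
Definition linked f := 
  [/\ forall k, (k < q)%N -> is_last f (a k) (v k) /\ is_first f (a k.+1) (v k)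
    & forall k, (k <= q)%N -> long L f (a k)].

(** Vertices of [a k.+1] have key at least that of [v k], vertices of earlier sets at most that, and
    keys are injective. *)
Lemma linked_capU f : linked f -> forall k, (k < q)%N ->
  a k.+1 :&: \bigcup_(i < k.+1) a i \subset [set v k].
Proof.
case=> lk _ k kq.
have mono j m : (j + m < q)%N -> (key f (v j) <= key f (v (j + m)))%N.
  elim: m => [|m IHm] jm; first by rewrite addn0.
  rewrite addnS in jm *; apply: leq_trans (IHm (ltnW jm)) _.
  have [/is_lastP[_ maxv] _] := lk _ jm; have [_ /is_firstP[vm _]] := lk _ (ltnW jm).
  exact: maxv.
apply/subsetP => x /setIP[xk /bigcupP[[j /= jk] _ xj]].
have [_ /is_firstP[_ /(_ x xk) le1]] := lk k kq.
have [/is_lastP[_ /(_ x xj) le2] _] := lk j (leq_trans jk kq).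
have := mono j (k - j)%N; rewrite subnKC // => /(_ kq) le3.
by rewrite inE; apply/eqP/(@key_inj _ _ f)/eqP; rewrite eqn_leq le1 (leq_trans le2).
Qed.

(** If [v k.+1] lay in an earlier set it would equal [v k], but the long edge [a k.+1] has different
    first and last vertices. *)
Lemma linked_vU f : linked f -> forall k, (k < q)%N ->
  v k \in a k :\: \bigcup_(i < k) a i.
Proof.
move=> lf k kq; have [lk longa] := lf; rewrite inE.
have [last_v _] := lk k kq; have [vk _] := is_lastP _ _ _ last_v; rewrite vk andbT.
case: k kq last_v vk => [|k] kq last_v vk; first by rewrite big_ord0 inE.
apply/negP => vU; have /subsetP/(_ (v k.+1)) := linked_capU lf (ltnW kq).
rewrite in_setI vk => /(_ vU); rewrite inE => /eqP eqv.
have [_ first_v] := lk k (ltnW kq).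
by have := long_first_last (longa _ (ltnW kq)) first_v last_v; rewrite eqv; lia.
Qed.

Lemma linked_lower f : linked f -> forall k, (k < q)%N -> (k.+1 * L <= f (v k))%N.
Proof.
case=> lk longa; elim=> [|k IHk] kq.
  have [/is_lastP[_ maxv] _] := lk 0%N kq.
  have [x [y [xa ya]]] := longP _ _ _ (longa _ (ltnW kq)).
  by have := key_le (maxv y ya); lia.
have [last_v _] := lk k.+1 kq; have [_ first_v] := lk k (ltnW kq).
have := long_first_last (longa _ (ltnW kq)) first_v last_v.
by have := IHk (ltnW kq); rewrite !mulSn; lia.
Qed.

Lemma linked_step f : linked f -> forall k, (k.+1 < q)%N ->
  (f (v k) + L <= f (v k.+1))%N.
Proof.
case=> lk longa k kq; have [last_v _] := lk k.+1 kq; have [_ first_v] := lk k (ltnW kq).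
exact: long_first_last (longa _ (ltnW kq)) first_v last_v.
Qed.

Lemma linked_upper f : linked f -> forall m, (m < q)%N ->
  (f (v (q - m.+1)) + m.+1 * L < N)%N.
Proof.
move=> lf; have [lk longa] := lf; elim=> [|m IHm] mq.
  have [_ /is_firstP[_ minv]] := lk (q - 1)%N ltac:(lia).
  rewrite (_ : (q - 1).+1 = q) in minv; last by lia.
  have [x [y [xa ya]]] := longP _ _ _ (longa _ (leqnn q)).
  by have := key_le (minv x xa); have := ltn_ord (f y); lia.
have := linked_step lf (k := q - m.+2) ltac:(lia).
rewrite (_ : (q - m.+2).+1 = q - m.+1)%N; last by lia.
by have := IHm (ltnW mq); rewrite !mulSn; lia.
Qed.

(** A vertex linking [a k] to [a k.+1] under [f] lies in their intersection, which [f0] already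
    confines to [v k]: one weighting determines the links for all. *)
Lemma linked_chain_event f f0 : linked f0 ->
    (forall k, (k < q)%N -> link f (a k) (a k.+1)) ->
    (forall k, (k <= q)%N -> long L f (a k)) -> linked f.
Proof.
move=> lf0 lf longf; split=> // k kq.
have /existsP[u /andP[last_u first_u]] := lf k kq.
suff -> : v k = u by [].
have [[uk _] [uk1 _]] := (is_lastP _ _ _ last_u, is_firstP _ _ _ first_u).
have /subsetP/(_ u) := linked_capU lf0 kq.
rewrite in_setI uk1 inE => h; apply/esym/eqP/h.
by apply/bigcupP; exists ord_max.
Qed.

Variables (P n : nat).
Hypothesis defN : ((q.+1 * L + P).+1 = N)%N.

(* The weights of the linking vertices [v 0], ..., [v (q - 1)], padded with the extreme
   weights [0] and [N - 1]; [s] holds the offsets [f (v j) - (j + 1) L]. *)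
Definition breaks (s : q.-tuple 'I_P.+1) (k : nat) : nat :=
  if k is j.+1 then if (j < q)%N then (nth 0 (map val s) j + k * L)%N else N.-1 else 0.

Arguments breaks : simpl never.

Lemma breaks_le_pred (s : q.-tuple 'I_P.+1) k : (breaks s k <= N.-1)%N.
Proof.
rewrite /breaks; case: k => // k; case: ifP => // kq.
have : (nth 0 (map val s) k < P.+1)%N.
  by rewrite (nth_map (tnth s (Ordinal kq))) ?size_tuple // ltn_ord.
have : (k.+1 * L <= q * L)%N by rewrite leq_mul2r kq orbT.
by move: defN; rewrite mulSn; lia.
Qed.

Lemma breaks_step (s : q.-tuple 'I_P.+1) k : sorted leq (map val s) -> (k <= q)%N ->
  (breaks s k + L <= breaks s k.+1)%N.
Proof.
move=> s_sorted; rewrite leq_eqVlt => /predU1P[->|kq]; last first.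
  rewrite /breaks; case: k kq => [|k] kq; first by rewrite kq; lia.
  rewrite kq (ltnW kq).
  have : (nth 0 (map val s) k <= nth 0 (map val s) k.+1)%N.
    by apply: (sortedP 0%N s_sorted); rewrite size_map size_tuple.
  by rewrite !mulSn; lia.
rewrite /breaks ltnn; case: q s defN {s_sorted} => [|m] s def; first by lia.
rewrite ltnSn.
have : (nth 0 (map val s) m < P.+1)%N.
  by rewrite (nth_map (tnth s ord_max)) ?size_tuple // ltn_ord.
by move: def; rewrite !mulSn; lia.
Qed.

(** Counts the weights between consecutive breaks, both ends included. Neighbouring intervals share
    an end, so the gaps add up to [N + q], the sum that enters AM-GM below. *)
Definition gap (s : q.-tuple 'I_P.+1) k : nat := (breaks s k.+1 - breaks s k).+1.

Lemma prod_gap_le (s : q.-tuple 'I_P.+1) : sorted leq (map val s) ->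
  \prod_(k < q.+1) ((gap s k)%:R / N%:R : R) <=
    ((N + q)%:R / (N%:R * q.+1%:R)) ^+ q.+1.
Proof.
move=> s_sorted.
have gap0 (i : 'I_q.+1) : i \in 'I_q.+1 -> 0 <= ((gap s i)%:R / N%:R : R).
  by move=> _; rewrite divr_ge0.
have [le _] := leif_AGM gap0; apply: le_trans le _; rewrite card_ord.
suff -> : \sum_(i < q.+1) ((gap s i)%:R / N%:R : R) = (N + q)%:R / N%:R.
  by rewrite -mulrA -invfM.
rewrite -mulr_suml -natr_sum; congr (_%:R / _).
have tele m : (m <= q.+1)%N -> (\sum_(i < m) gap s i = breaks s m + m)%N.
  elim: m => [|m IHm] mq; first by rewrite big_ord0.
  rewrite big_ord_recr /= IHm ?(ltnW mq) // /gap.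
  by have := breaks_step s_sorted mq; lia.
by rewrite tele // /breaks ltnn; lia.
Qed.

(** The weights allowed at [x] once the breaks are fixed. At a link two adjacent intervals meet in a
    single point. *)
Definition windows (s : q.-tuple 'I_P.+1) x : {set 'I_N} :=
  [set y : 'I_N | [forall k : 'I_q.+1, (x \in a k) ==> (breaks s k <= y <= breaks s k.+1)%N]].

Lemma windows_bounds (s : q.-tuple 'I_P.+1) x y k : (k <= q)%N -> x \in a k ->
  y \in windows s x -> (breaks s k <= y <= breaks s k.+1)%N.
Proof.
move=> kq xk; rewrite inE => /forallP/(_ (Ordinal (kq : (k < q.+1)%N))).
by move/implyP; apply.
Qed.

Lemma linked_windows f : linked f -> exists2 s : q.-tuple 'I_P.+1,
  sorted leq (map val s) & f \in finfun.family (windows s).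
Proof.
move=> lf; have [lk longa] := lf.
pose s0 k := (f (v k) - k.+1 * L)%N.
have s0P k : (k < q)%N -> (s0 k <= P)%N.
  move=> kq; have := linked_upper lf (m := q - k.+1) ltac:(lia).
  rewrite (_ : q - (q - k.+1).+1 = k)%N; last by lia.
  have : ((q - k.+1).+1 * L + k.+1 * L = q.+1 * L)%N by rewrite -mulnDl; congr muln; lia.
  by move: defN; rewrite /s0; lia.
have val_s : map val [tuple inord (s0 i) : 'I_P.+1 | i < q] = mkseq s0 q.
  apply: (@eq_from_nth _ 0%N) => [|i]; first by rewrite size_map size_tuple size_mkseq.
  rewrite size_map size_tuple => iq.
  rewrite nth_mkseq // (nth_map (inord 0)) ?size_tuple //.
  by rewrite -(tnth_nth _ _ (Ordinal iq)) tnth_mktuple /= inordK // ltnS s0P.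
exists [tuple inord (s0 i) : 'I_P.+1 | i < q].
  rewrite val_s; apply/(sortedP 0%N) => i; rewrite size_mkseq => iq.
  rewrite !nth_mkseq ?(ltnW iq) // /s0.
  by have := linked_step lf iq; rewrite !mulSn; lia.
apply/familyP => x; rewrite inE; apply/forallP => -[k /= kq]; apply/implyP => xk.
rewrite /breaks val_s; apply/andP; split.
  case: k kq xk => // k kq xk; rewrite ltnS in kq; rewrite kq nth_mkseq //.
  have := linked_lower lf kq; have [_ /is_firstP[_ /(_ x xk)/key_le]] := lk k kq.
  by rewrite /s0; lia.
case: ifP => kq'; last by have := ltn_ord (f x); lia.
have := linked_lower lf kq'; have [/is_lastP[_ /(_ x xk)/key_le le] _] := lk k kq'.
by rewrite nth_mkseq // /s0; lia.
Qed.

(** The box has product probability, so [prodr_chain] applies with [gap / N] for a general vertex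
    and [1 / N] for a link; AM-GM then bounds the product of gaps. *)
Lemma pr_windows f0 (s : q.-tuple 'I_P.+1) : linked f0 ->
    (forall k, (k <= q)%N -> #|a k| = n) -> sorted leq (map val s) ->
  pr R [set f : {ffun V -> 'I_N} in finfun.family (windows s)] <=
    N%:R^-1 ^+ q * (((N + q)%:R / (N%:R * q.+1%:R)) ^+ q.+1) ^+ (n - 2).
Proof.
move=> lf0 card_a s_sorted; rewrite pr_family.
have N0 : 0 < (N%:R : R) by rewrite ltr0n; lia.
apply: (@le_trans _ _ (N%:R^-1 ^+ q *
    (\prod_(k < q.+1) ((gap s k)%:R / N%:R : R)) ^+ (n - 2))); last first.
  rewrite ler_wpM2l ?exprn_ge0 ?invr_ge0 ?ler0n //.
  apply: lerXn2r; rewrite ?nnegrE ?prod_gap_le ?exprn_ge0 ?divr_ge0 ?mulr_ge0 ?ler0n //.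
  by apply: prodr_ge0 => i _; rewrite divr_ge0.
apply: (@prodr_chain R V a v q n _ (fun k => (gap s k)%:R / N%:R) _ card_a
          (linked_capU lf0) (linked_vU lf0)) => [x|k x kq xk|k kq|k kq].
- exact: frac_le1.
- rewrite card_ord ler_wpM2r ?invr_ge0 ?ler0n // ler_nat.
  apply: leq_trans (card_window N (breaks s k) (gap s k)).
  apply/subset_leq_card/subsetP => y /(windows_bounds kq xk); rewrite inE.
  by have := breaks_step s_sorted kq; rewrite /gap; lia.
- rewrite divr_ge0 //= ler_pdivrMr // mul1r ler_nat /gap.
  by have := breaks_le_pred s k.+1; lia.
(* The link [v k] lies in [a k] and in [a k.+1], which forces its weight to be [breaks s k.+1]. *)
rewrite card_ord ler_pdivrMr // mulVf ?gt_eqF //.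
rewrite -[1]/(1%:R) ler_nat.
apply: leq_trans (card_window N (breaks s k.+1) 1).
have [lk _] := lf0; have [/is_lastP[vk _] /is_firstP[vk1 _]] := lk k kq.
apply/subset_leq_card/subsetP => y yw; rewrite inE.
have := windows_bounds (ltnW kq) vk yw; have := windows_bounds kq vk1 yw; lia.
Qed.

End ChainStructure.

(** A nonempty event supplies [f0], which fixes the links. The event is then covered by boxes, one
    for each sorted [q]-tuple of offsets in $[0, P]$, which the binomial coefficient counts. *)
Lemma pr_chain_event (c : seq {set V}) q n P :
    (0 < L)%N -> ((q.+1 * L + P).+1 = N)%N ->
    size c = q.+1 -> all (fun A : {set V} => #|A| == n) c ->
  pr R (chain_event c) <= 'C(q + P, q)%:R *
    (N%:R^-1 ^+ q * (((N + q)%:R / (N%:R * q.+1%:R)) ^+ q.+1) ^+ (n - 2)).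
Proof.
move=> L0 defN sc card_c; pose a := nth set0 c.
have ev f : f \in chain_event c -> (forall k, (k < q)%N -> link f (a k) (a k.+1)) /\
    (forall k, (k <= q)%N -> long L f (a k)).
  rewrite inE => /andP[/(sortedP set0) lc /(all_nthP set0) longc]; split=> k kq.
    by apply: lc; rewrite sc ltnS.
  by apply: longc; rewrite sc ltnS.
have [->|[f0 /ev[link0 long0]]] := set_0Vmem (chain_event c).
  by rewrite pr0 !mulr_ge0 ?exprn_ge0 ?invr_ge0 ?divr_ge0 ?mulr_ge0 ?ler0n.
have [x0 _] : exists x, x \in a 0%N.
  by have [x [_ [xa _ _]]] := longP _ _ _ (long0 0%N isT); exists x.
pose v k := odflt x0 [pick u | is_last f0 (a k) u && is_first f0 (a k.+1) u].
have lf0 : linked q a v f0.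
  split=> // k kq; rewrite /v; case: pickP => [u /andP[]|none] //.
  by have /existsP[u] := link0 k kq; rewrite none.
have card_a k : (k <= q)%N -> #|a k| = n.
  by move=> kq; apply/eqP/(all_nthP set0 card_c); rewrite sc ltnS.
pose S := [set s : q.-tuple 'I_P.+1 | sorted leq (map val s)].
have sub : chain_event c \subset \bigcup_(s in S)
    [set f : {ffun V -> 'I_N} in finfun.family (windows a s)].
  apply/subsetP => f /ev[linkf longf].
  have lf := linked_chain_event lf0 linkf longf.
  have [s s_sorted fs] := linked_windows L0 defN lf.
  by apply/bigcupP; exists s; rewrite inE.
apply: le_trans (pr_sub R sub) _; apply: le_trans (pr_bigcup R _ _) _.
rewrite -card_sorted_tuples mulr_natl -sumr_const.
by apply: ler_sum => s; rewrite inE; apply: pr_windows lf0 _.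
Qed.

End Events.

(** * Applying the local lemma to a hypergraph *)

Section Assembly.
Variables (R : realFieldType) (V : finType) (E : {set {set V}}) (n q D N L P : nat).
Hypothesis n0 : (0 < n)%N.
Hypothesis L0 : (0 < L)%N.
Hypothesis defN : (q.+1 * L + P).+1 = N.
Hypothesis uniE : uniform n E.
Hypothesis degE : (max_edge_degree E <= D)%N.
Implicit Types (f g : {ffun V -> 'I_N}) (A B : {set V}).

Definition adj A B := [&& A \in E, B \in E, B != A & A :&: B != set0].
Definition nbh A := [set B in E | A :&: B != set0].

Lemma adj_sym : symmetric adj.
Proof. by move=> A B; rewrite /adj setIC eq_sym; case: (A \in E); case: (B \in E). Qed.

Lemma edge_degree_le A : A \in E -> (edge_degree E A <= D)%N.
Proof. by move=> AE; apply: leq_trans degE; rewrite /max_edge_degree (bigD1 A) // leq_maxl. Qed.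

Lemma adj_deg A : (#|adj A| <= D)%N.
Proof.
have [AE|nAE] := boolP (A \in E); last first.
  by rewrite eq_card0 // => B; rewrite unfold_in /adj (negPf nAE).
apply: leq_trans (edge_degree_le AE); apply/subset_leq_card/subsetP => B.
by rewrite unfold_in => /and4P[_ BE BA AB]; rewrite inE BE BA.
Qed.

Lemma card_nbh A : A \in E -> (#|nbh A| <= D.+1)%N.
Proof.
move=> AE; apply: (@leq_trans #|A |: [set B in E | (B != A) && (A :&: B != set0)]|).
  apply/subset_leq_card/subsetP => B; rewrite !inE => /andP[-> ->].
  by case: eqP.
by rewrite (leq_trans (leq_card_setU _ _)) // cards1 add1n ltnS edge_degree_le.
Qed.

Lemma card_edge A : A \in E -> #|A| = n.
Proof. by move=> AE; apply/eqP; move/forall_inP: uniE; apply. Qed.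

(** Indices range over arbitrary sets and tuples of sets; [event] assigns the empty event to those
    that are not [valid]. *)
Definition event_index := ({set V} + q.+1.-tuple {set V})%type.
Definition edges (j : event_index) : seq {set V} :=
  match j with inl A => [:: A] | inr c => c end.
Definition valid (j : event_index) :=
  all [in E] (edges j) && if j is inr c then sorted adj c else true.
Definition event (j : event_index) : {set {ffun V -> 'I_N}} :=
  if valid j then
    match j with inl A => short_event N L A | inr c => chain_event N L c end
  else set0.
Definition supp j : {set V} := \bigcup_(A <- edges j) A.
(** A valid index is its own neighbour, edges being nonempty, so a bound on neighbour sums also
    bounds single events. *)
Definition nbr i j := [&& valid i, valid j & has (fun A => has [in nbh A] (edges j)) (edges i)].

Lemma edge_sub_supp j A : A \in edges j -> A \subset supp j.
Proof.
rewrite /supp; elim: (edges j) => //= B s IHs; rewrite inE big_cons.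
by case/predU1P=> [->|/IHs sA]; [apply: subsetUl | apply: subset_trans (subsetUr _ _)].
Qed.

Lemma suppP j x : reflect (exists2 A, A \in edges j & x \in A) (x \in supp j).
Proof.
apply: (iffP idP) => [|[A /edge_sub_supp/subsetP sA /sA] //].
rewrite /supp; elim: (edges j) => [|B s IHs]; first by rewrite big_nil inE.
rewrite big_cons inE => /orP[xB|/IHs[A As xA]]; first by exists B; rewrite ?mem_head.
by exists A; rewrite // inE As orbT.
Qed.

Lemma key_agree (S : {set V}) f g : {in S, f =1 g} -> {in S, key f =1 key g}.
Proof. by move=> fg x xS; rewrite /key fg. Qed.

Lemma long_agree (S : {set V}) f g A : {in S, f =1 g} -> A \subset S ->
  long L f A -> long L g A.
Proof.
move=> fg /subsetP AS /longP[x [y [xA yA xy]]]; apply/longP; exists x, y.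
by rewrite -!fg ?AS.
Qed.

Lemma link_agree (S : {set V}) f g : {in S, f =1 g} ->
  {in [pred A : {set V} | A \subset S] &, subrel (link f) (link g)}.
Proof.
move=> /key_agree fg A B /subsetP AS /subsetP BS /existsP[u /andP[lu fu]].
have [[uA maxu] [uB minu]] := (is_lastP _ _ _ lu, is_firstP _ _ _ fu).
apply/existsP; exists u; apply/andP; split.
  by apply/is_lastP; split=> // x xA; rewrite -!fg ?AS ?maxu.
by apply/is_firstP; split=> // x xB; rewrite -!fg ?BS ?minu.
Qed.

Lemma event_supp j : depends_on (supp j) (event j).
Proof.
move=> f g fg; rewrite /event; case: (valid j); last by rewrite inE.
have sub := @edge_sub_supp j; case: j fg sub => [A|c] fg sub; rewrite !inE.
  apply: contra; apply: (long_agree (S := supp (inl A))); last by apply: sub; rewrite inE.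
  by move=> x xS; rewrite fg.
case/andP=> lc /allP longc; apply/andP; split; last first.
  by apply/allP => A Ac; apply: long_agree fg _ (longc A Ac); apply: sub.
apply: (sub_in_sorted (link_agree fg)) lc.
by apply/allP => A; apply: sub.
Qed.

(** Edges of non-neighbours are disjoint from those of [i], so the events depend on disjoint sets of
    coordinates. *)
Lemma event_indep i (K : {set event_index}) : (forall j, j \in K -> ~~ nbr i j) ->
  pr R (event i :&: avoid event K) = pr R (event i) * pr R (avoid event K).
Proof.
move=> nK; have [vi|/negPf nvi] := boolP (valid i); last first.
  by rewrite /event nvi set0I !pr0 mul0r.
apply: (pr_setI_indep R _ (@event_supp i)).
  by rewrite card_ffun card_ord expn_gt0; lia.
apply: depends_on_avoid => j /nK; rewrite /nbr vi /=.
case: (boolP (valid j)) => [vj|nvj _ f g _]; last by rewrite /event (negPf nvj) inE.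
move=> nhas f g fg; apply: event_supp => x xj; apply: fg; rewrite inE.
apply: contra nhas => /suppP[A Ai xA]; have /suppP[B Bj xB] := xj.
apply/hasP; exists A => //; apply/hasP; exists B => //.
rewrite inE; case/andP: vj => /allP/(_ B Bj) -> _.
by apply/set0Pn; exists x; rewrite inE xA.
Qed.

Definition p_short : R := N%:R * (L%:R / N%:R) ^+ n.
Definition p_chain : R := 'C(q + P, q)%:R *
  (N%:R^-1 ^+ q * (((N + q)%:R / (N%:R * q.+1%:R)) ^+ q.+1) ^+ (n - 2)).

Lemma p_chain_ge0 : 0 <= p_chain.
Proof.
by rewrite !mulr_ge0 ?exprn_ge0 ?invr_ge0 ?divr_ge0 ?mulr_ge0 ?ler0n.
Qed.

Lemma p_short_ge0 : 0 <= p_short.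
Proof. by rewrite mulr_ge0 ?exprn_ge0 ?divr_ge0 ?ler0n. Qed.

(** Near [A] there are at most [D.+1] short-edge events, and at most $r(D+1)D^q$ chain events since
    a valid chain is a walk in [adj] meeting [nbh A]. *)
Lemma sum_around A : A \in E ->
  \sum_(j | valid j && has [in nbh A] (edges j)) pr R (event j) <=
    D.+1%:R * p_short + q.+1%:R * (D.+1%:R * D%:R ^+ q) * p_chain.
Proof.
move=> AE; rewrite big_sumType /=; apply: lerD.
  apply: (@le_trans _ _ (\sum_(B in nbh A) p_short)); last first.
    by rewrite sumr_const -[p_short *+ _]mulr_natl ler_wpM2r ?p_short_ge0 // ler_nat card_nbh.
  apply: (@le_trans _ _ (\sum_(B in nbh A) pr R (event (inl B)))).
    apply: ler_sum_subpred => [B /andP[_]|B _]; last exact: pr_ge0.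
    by rewrite orbF.
  apply: ler_sum => B; rewrite inE => /andP[BE _].
  rewrite /event /valid /= BE; apply: pr_short_event => //; first exact: card_edge.
  by move: defN; rewrite mulSn; lia.
set S := [set c : q.+1.-tuple {set V} | sorted adj c && has [in nbh A] c].
apply: (@le_trans _ _ (\sum_(c in S) p_chain)); last first.
  rewrite sumr_const -[p_chain *+ _]mulr_natl ler_wpM2r ?p_chain_ge0 // -natrX -!natrM ler_nat.
  apply: leq_trans (card_walks_meeting adj_sym adj_deg (nbh A) q.+1) _.
  by rewrite leq_mul2l /= leq_mul2r card_nbh ?orbT.
apply: (@le_trans _ _ (\sum_(c in S) pr R (event (inr c)))).
  apply: ler_sum_subpred => [c /andP[/andP[_ sc] hc]|c _]; last exact: pr_ge0.
  by rewrite inE sc.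
apply: ler_sum => c; rewrite inE => /andP[sc _]; rewrite /event.
case: ifP => [/andP[/allP cE _]|_]; last by rewrite pr0 p_chain_ge0.
apply: pr_chain_event => //; first by rewrite size_tuple.
by apply/allP => B /cE /card_edge ->.
Qed.

Lemma sum_nbr i : \sum_(j | nbr i j) pr R (event j) <=
  q.+1%:R * (D.+1%:R * p_short + q.+1%:R * (D.+1%:R * D%:R ^+ q) * p_chain).
Proof.
set sigma := (X in _ * X).
have sigma0 : 0 <= sigma.
  apply: addr_ge0; first exact: mulr_ge0 (ler0n _ _) p_short_ge0.
  by apply: mulr_ge0 p_chain_ge0; rewrite !mulr_ge0 ?exprn_ge0 ?ler0n.
have [vi|nvi] := boolP (valid i); last first.
  by rewrite big_pred0 ?mulr_ge0 // => j; rewrite /nbr (negPf nvi).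
have /andP[/allP iE _] := vi.
have -> : \sum_(j | nbr i j) pr R (event j) =
    \sum_(j | valid j && has (fun A => has [in nbh A] (edges j)) (edges i)) pr R (event j).
  by apply: eq_bigl => j; rewrite /nbr vi.
have size_i : (size (edges i) <= q.+1)%N by case: (i) => //= c; rewrite size_tuple.
apply: le_trans (ler_wpM2r sigma0 (_ : (size (edges i))%:R <= _)); last by rewrite ler_nat.
elim: (edges i) iE => [|A s IHs] iE /=.
  by rewrite mul0r big_pred0 // => j; rewrite andbF.
rewrite -nat1r mulrDl mul1r.
apply: le_trans (lerD (sum_around (iE A (mem_head _ _))) (IHs _)); last first.
  by move=> B Bs; apply: iE; rewrite inE Bs orbT.
rewrite [leLHS]big_mkcond [X in _ <= X + _]big_mkcond [X in _ <= _ + X]big_mkcond.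
rewrite -big_split /=; apply: ler_sum => j _; have := pr_ge0 R (event j).
by case: (valid j); case: (has [in nbh A] (edges j)); case: (has _ s) => /=; lra.
Qed.

Lemma colorable_of_small_sum :
  q.+1%:R * (D.+1%:R * p_short + q.+1%:R * (D.+1%:R * D%:R ^+ q) * p_chain) <= 4^-1 ->
  chromatic_number_le E q.+1.
Proof.
move=> small.
have sum4 i : \sum_(j | nbr i j) pr R (event j) <= 4^-1 := le_trans (sum_nbr i) small.
have pr4 i : pr R (event i) <= 4^-1.
  have [vi|nvi] := boolP (valid i); last by rewrite /event (negPf nvi) pr0; lra.
  apply: le_trans (sum4 i); rewrite (bigD1 i) /=.
    by rewrite lerDl sumr_ge0 // => j _; apply: pr_ge0.
  rewrite /nbr vi /=; have /andP[/allP iE _] := vi.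
  have [A Ai] : exists A, A \in edges i.
    case: (i) => [A|c] /=; first by exists A; rewrite inE.
    by exists (thead c); rewrite mem_tnth.
  apply/hasP; exists A => //; apply/hasP; exists A => //.
  have AE : A \in E := iE A Ai.
  by rewrite inE AE setIid -card_gt0 (card_edge AE).
have O0 : (0 < #|{ffun V -> 'I_N}|)%N by rewrite card_ffun card_ord expn_gt0; lia.
have [f good] := local_lemma event_indep sum4 pr4 O0.
have longE A : A \in E -> long L f A.
  by move=> AE; have := good (inl A); rewrite /event /valid /= AE inE negbK.
apply: (coloring_of_no_chain (f := f) L0) => // c cE.
apply/negP => lc; have := good (inr c); rewrite /event /valid /= cE /=.
(* Linked edges share a vertex, and they differ because the first and last vertices of a long edge
   differ. *)
have -> : sorted adj c.
  apply: (sub_in_sorted _ cE lc) => A B AE BE /existsP[u /andP[lu fu]].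
  have [[uA _] [uB _]] := (is_lastP _ _ _ lu, is_firstP _ _ _ fu).
  have AE' : A \in E by []. have BE' : B \in E by [].
  rewrite /adj AE' BE' /=; apply/andP; split; last by apply/set0Pn; exists u; rewrite inE uA.
  apply/eqP => eqBA; rewrite eqBA in fu.
  by have := long_first_last (longE _ AE') fu lu; lia.
by rewrite inE lc; apply/negP; rewrite negbK; apply/allP => A /(allP cE)/longE.
Qed.

End Assembly.

(** * Parameters *)

Lemma bin_le_exp2 n k : ('C(n, k) <= 2 ^ n)%N.
Proof.
rewrite -{1}(card_ord n) -card_draws; apply: leq_trans (max_card _) _.
by rewrite -cardsT -powersetT card_powerset cardsT card_ord.
Qed.

(** A weak Stirling bound: $k^k \le 2k(2k-1)\cdots(k+1) = \binom{2k}{k}\, k! \le 4^k k!$. *)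
Lemma expn_self_le_fact k : (k ^ k <= 4 ^ k * k`!)%N.
Proof.
apply: (@leq_trans (k.*2 ^_ k)).
  have -> : (k ^ k = \prod_(i < k) k)%N by rewrite prod_nat_const card_ord.
  rewrite ffact_prod; apply: leq_prod => i _.
  by have := ltn_ord i; lia.
rewrite -bin_ffact leq_mul2r; apply/orP; right.
by apply: leq_trans (bin_le_exp2 _ _) _; rewrite -mul2n expnM.
Qed.

Lemma ffact_le_exp n m : (n ^_ m <= n ^ m)%N.
Proof.
have -> : (n ^ m = \prod_(i < m) n)%N by rewrite prod_nat_const card_ord.
rewrite ffact_prod; apply: leq_prod => i _.
exact: leq_subr.
Qed.

(** * Numerical verification of the local lemma condition *)

Section Numerics.
Variables (R : realFieldType) (n q d D : nat) (c X Y : R).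
Hypotheses (n2 : (2 <= n)%N) (q0 : (0 < q)%N) (d0 : (0 < d)%N) (dn : (d < n)%N).
Hypothesis le_rn : (q.+1 <= n)%N.

Let n1S : (n - 1 = (n - 2).+1)%N. Proof. lia. Qed.
(** With $N = rn$ and $L = n - d$, the [r] long edges of a chain leave only a slack of $P + 1 = rd$
    weights. *)
Let N := (q.+1 * n)%N.
Let L := (n - d)%N.
Let P := (q.+1 * d).-1.
Let n0 : (0 < n)%N. Proof. lia. Qed.
Let L0 : (0 < L)%N. Proof. by rewrite subn_gt0. Qed.
Let defN : (q.+1 * L + P).+1 = N.
Proof.
rewrite /P /L /N mulnBr; have : (q.+1 * d <= q.+1 * n)%N by rewrite leq_mul2l ltnW.
have : (0 < q.+1 * d)%N by rewrite muln_gt0.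
lia.
Qed.

Hypothesis c0 : 0 <= c.
Hypothesis c_small : 8 * (8 * (8 * (8 * c))) <= 1.
Hypotheses (Y0 : 0 <= Y) (YX : Y <= X) (Xn : X <= n%:R) (YrXq : Y ^+ q.+1 = X ^+ q).
Hypothesis short_decay : ((n - d)%:R / n%:R) ^+ n <= (n%:R : R)^-1 ^+ 3.
Hypothesis exp_bound : (1 + (n%:R : R)^-1) ^+ n <= 3.
Hypothesis Xd : X * d.+1%:R <= 5 * n%:R.
Hypothesis D_small : D.+1%:R <= 2 * c * Y * q.+1%:R ^+ (n - 1).

Let rho0 : 0 < (q.+1%:R : R). Proof. by rewrite ltr0n. Qed.
Let nu0 : 0 < (n%:R : R). Proof. by rewrite ltr0n. Qed.

(** After the powers of [r] cancel, $2c\,Y r n (L/n)^n$ remains; [Y], [r] and [n] are each at most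
    [n], and the last factor is at most $n^{-3}$. *)
Lemma short_sum : q.+1%:R * (D.+1%:R * p_short R n N L) <= 8^-1.
Proof.
have -> : p_short R n N L =
    q.+1%:R * n%:R * ((L%:R / n%:R) ^+ n * (q.+1%:R ^+ (n - 1) * q.+1%:R)^-1).
  rewrite /p_short /N natrM -exprSr (_ : (n - 1).+1 = n); last by lia.
  by rewrite -exprVn -exprMn invfM; congr (_ * _ ^+ _); ring.
have X0 : 0 <= X := le_trans Y0 YX.
have r1n : (q.+1%:R : R) <= n%:R by rewrite ler_nat.
have r0 := rho0; have v0 := nu0; have Xv := Xn; have Ds := D_small.
set rho : R := q.+1%:R in r1n r0 Ds *; set nu : R := n%:R in r1n v0 Xv *.
set u := _ ^+ n; set e := rho ^+ (n - 1) in Ds *.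
have e0 : 0 < e by rewrite exprn_gt0.
have u0 : 0 <= u by rewrite exprn_ge0 ?divr_ge0 ?ler0n.
have un : u <= nu^-1 ^+ 3 by [].
clearbody rho nu e u.
apply: (@le_trans _ _ (rho * ((2 * c * Y * e) * (rho * nu * (u * (e * rho)^-1))))).
  rewrite ler_wpM2l ?(ltW r0) // ler_wpM2r //.
  by rewrite !mulr_ge0 ?invr_ge0 ?mulr_ge0 ?(ltW r0) ?(ltW v0) ?(ltW e0).
have -> : rho * ((2 * c * Y * e) * (rho * nu * (u * (e * rho)^-1))) =
    2 * c * (Y * rho * nu * u).
  by field; rewrite !gt_eqF.
have : Y * rho * nu * u <= nu * nu * nu * nu^-1 ^+ 3.
  rewrite ler_pM ?mulr_ge0 ?(ltW r0) ?(ltW v0) // ler_wpM2r ?(ltW v0) //.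
  by rewrite ler_pM ?(ltW r0) // (le_trans YX).
have -> : nu * nu * nu * nu^-1 ^+ 3 = 1 by field; rewrite gt_eqF.
move=> h; apply: (@le_trans _ _ (2 * c * 1)); last by move: c_small c0; lra.
by rewrite ler_wpM2l ?mulr_ge0.
Qed.

(** Uses $\binom{q+P}{q} \le (q+P)^q/q!$ with $q + P \le r(d+1)$, and $(N+q)/N \le 1 + 1/n$, whose
    power $n-2$ is at most 3. *)
Lemma p_chain_le : p_chain R n q N P <=
  (q.+1%:R * d.+1%:R) ^+ q / q`!%:R * ((q.+1%:R * n%:R)^-1 ^+ q *
    (3 ^+ q.+1 * (q.+1%:R ^+ (n - 2) ^+ q.+1)^-1)).
Proof.
have N0 : (0 < N)%N by rewrite muln_gt0; lia.
rewrite /p_chain; apply: ler_pM.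
- exact: ler0n.
- by rewrite mulr_ge0 ?exprn_ge0 ?invr_ge0 ?divr_ge0 ?mulr_ge0 ?ler0n.
- rewrite ler_pdivlMr ?ltr0n ?fact_gt0 // -!natrM -natrX ler_nat bin_ffact.
  apply: leq_trans (ffact_le_exp _ _) _; rewrite leq_exp2r //.
  by rewrite /P; nia.
rewrite [N%:R](natrM _ _ _); apply: ler_wpM2l.
  by rewrite exprn_ge0 ?invr_ge0 ?mulr_ge0 ?ler0n.
rewrite -[X in X <= _]exprM mulnC exprM -exprVn -exprMn.
apply: lerXn2r; rewrite ?nnegrE.
- by rewrite exprn_ge0 ?divr_ge0 ?mulr_ge0 ?ler0n.
- by rewrite mulr_ge0 ?invr_ge0 ?exprn_ge0 ?ler0n.
apply: (@le_trans _ _ (((1 + n%:R^-1) / q.+1%:R) ^+ (n - 2))).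
  apply: lerXn2r; rewrite ?nnegrE ?divr_ge0 ?mulr_ge0 ?addr_ge0 ?invr_ge0 ?ler0n //.
  rewrite invfM mulrA ler_wpM2r ?invr_ge0 ?ler0n // natrD mulrDl.
  rewrite /N natrM divff ?mulf_neq0 ?gt_eqF // lerD2l ler_pdivrMr ?mulr_gt0 //.
  by rewrite [_ * n%:R]mulrC mulrA mulVf ?gt_eqF // mul1r ler_nat.
rewrite exprMn -exprVn ler_wpM2r ?exprn_ge0 ?invr_ge0 ?ler0n //.
apply: le_trans exp_bound; apply: ler_weXn2l; last by lia.
by rewrite lerDl invr_ge0 ler0n.
Qed.

(** The identity $Y^r = X^{r-1}$ lets $X^q$ cancel against $((d+1)/n)^q$ up to $5^q$, and the powers
    of [r] reduce to $r^2\, r^r/q!$, which is at most exponential in [r]. *)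
Lemma chain_sum :
  q.+1%:R * (q.+1%:R * (D.+1%:R * D%:R ^+ q) * p_chain R n q N P) <= 8^-1.
Proof.
have X0 : 0 <= X := le_trans Y0 YX.
have pc := p_chain_le; have pc0 := p_chain_ge0 R n q N P.
have DD : D.+1%:R * D%:R ^+ q <= (2 * c) ^+ q.+1 * X ^+ q * (q.+1%:R ^+ (n - 1)) ^+ q.+1.
  rewrite -YrXq -!exprMn [leRHS]exprS.
  apply: ler_pM => //; rewrite ?exprn_ge0 ?ler0n //.
  apply: lerXn2r; rewrite ?nnegrE ?ler0n ?(le_trans _ D_small) ?ler0n // ler_nat.
  exact: leqnSn.
have self : (q.+1%:R : R) ^+ q.+1 / q`!%:R <= q.+1%:R * 4 ^+ q.+1.
  rewrite ler_pdivrMr ?ltr0n ?fact_gt0 // -!natrX -!natrM ler_nat.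
  by have := expn_self_le_fact q.+1; rewrite factS mulnCA mulnA.
have r2 : (q.+1%:R : R) <= 2 ^+ q.+1 by rewrite -natrX ler_nat ltnW // ltn_expl.
have r0 := rho0; have v0 := nu0; have Xw := Xd.
set rho : R := q.+1%:R in pc DD self r2 r0 *; set nu : R := n%:R in pc v0 Xw *.
set f : R := q`!%:R in pc self.
have f0 : 0 < f by rewrite ltr0n fact_gt0.
set t := _ ^+ (n - 2) in pc; have en : rho ^+ (n - 1) = t * rho.
  by rewrite -exprSr n1S.
have t0 : 0 < t by rewrite exprn_gt0.
set w : R := d.+1%:R in Xw pc.
have w0 : 0 <= w by rewrite ler0n.
rewrite en in DD.
apply: (@le_trans _ _ (rho * (rho * ((2 * c) ^+ q.+1 * X ^+ q * (t * rho) ^+ q.+1) *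
   ((rho * w) ^+ q / f * ((rho * nu)^-1 ^+ q * (3 ^+ q.+1 * (t ^+ q.+1)^-1)))))).
  rewrite ler_wpM2l ?(ltW r0) // ler_pM // ?mulr_ge0 ?exprn_ge0 ?ler0n ?(ltW r0) //.
  by rewrite ler_wpM2l ?(ltW r0).
have -> : rho * (rho * ((2 * c) ^+ q.+1 * X ^+ q * (t * rho) ^+ q.+1) *
   ((rho * w) ^+ q / f * ((rho * nu)^-1 ^+ q * (3 ^+ q.+1 * (t ^+ q.+1)^-1)))) =
   rho * rho * (6 * c) ^+ q.+1 * (X * w / nu) ^+ q * (rho ^+ q.+1 / f).
  rewrite !exprMn !exprVn !exprMn -[6](_ : 2 * 3 = 6 :> R); last by ring.
  rewrite !exprMn; field.
  by rewrite !expf_neq0 ?gt_eqF.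
have Xwq : (X * w / nu) ^+ q <= 5 ^+ q.+1.
  apply: (@le_trans _ _ (5 ^+ q)); last by apply: ler_weXn2l; rewrite ?ler1n.
  apply: lerXn2r; rewrite ?nnegrE ?divr_ge0 ?mulr_ge0 ?(ltW v0) //.
  by rewrite ler_pdivrMr.
apply: (@le_trans _ _ (2 ^+ q.+1 * 2 ^+ q.+1 * (6 * c) ^+ q.+1 * 5 ^+ q.+1 *
   (2 ^+ q.+1 * 4 ^+ q.+1))).
  apply: ler_pM; rewrite ?mulr_ge0 ?exprn_ge0 ?mulr_ge0 ?invr_ge0 ?(ltW r0) ?(ltW f0) ?(ltW v0) //.
    apply: ler_pM; rewrite ?mulr_ge0 ?exprn_ge0 ?mulr_ge0 ?invr_ge0 ?(ltW r0) ?(ltW v0) //.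
    rewrite ler_wpM2r ?exprn_ge0 ?mulr_ge0 //.
    by apply: ler_pM; rewrite ?(ltW r0).
  by apply: le_trans self _; rewrite ler_wpM2r ?exprn_ge0.
rewrite -!exprMn.
(* The collected base is $2 \cdot 2 \cdot 6c \cdot 5 \cdot 2 \cdot 4 = 960c$, below $1/4$ as $c \le
   1/4096$; then $r \ge 2$ gives $1/16$. *)
apply: (@le_trans _ _ (4^-1 ^+ q.+1)).
  by apply: lerXn2r; rewrite ?nnegrE; move: c0 c_small; lra.
apply: (@le_trans _ _ (4^-1 ^+ 2)); last by lra.
by apply: ler_wiXn2l; rewrite ?ltnS //; lra.
Qed.

Lemma colorable_of_numerics (V : finType) (E : {set {set V}}) :
  uniform n E -> (max_edge_degree E <= D)%N -> chromatic_number_le E q.+1.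
Proof.
move=> uniE degE.
apply: (@colorable_of_small_sum R V E n q D N L P) => //.
by rewrite mulrDr; have := lerD short_sum chain_sum; lra.
Qed.

End Numerics.

(* Transfer to the real numbers and conclusion *)
Close Scope ring_scope.
Delimit Scope R_scope with R.
Delimit Scope ring_scope with ring.

Lemma IZR_natr (k : nat) : IZR (Z.of_nat k) = (k%:R)%ring.
Proof. by rewrite -INR_IZR_INZ INRE. Qed.

Theorem theorem3 (r : nat -> nat) (hr2 : forall n : nat, (2 <= r n)%N)
  (hro : little_o_lnlnln r) :
  exists (c : R) (n0 : nat), (0 < c)%R /\
    forall n : nat, (n0 <= n)%N ->
      forall (V : finType) (E : {set {set V}}),
        uniform n E ->
        (INR (max_edge_degree E) <
           c * Rpower (INR n / ln (INR n)) ((INR (r n) - 1) / INR (r n))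
             * INR (r n) ^ (n - 1))%R ->
        chromatic_number_le E (r n).
Proof.
have [n1 r_le] := little_o_le hro.
exists (/ 4096)%R, (maxn n1 27); split; first by apply: Rinv_0_lt_compat; Lra.lra.
move=> n; rewrite geq_max => /andP[n1n n27] V E uniE.
have := r_le n n1n; have := hr2 n; case: (r n) => [|q] //; rewrite ltnS => q0 rn D_lt.
have [d [X [Y]]] := large_n_estimates n27 q0 D_lt.
rewrite !INRE in rn *.
move=> [d0 [dn [Y0 [YX [Xn [YrXq [short_decay [exp_bound [Xd D_small]]]]]]]]].
have q_lt_n : (q < n)%N by move/RleP: rn; rewrite ler_nat.
rewrite !RpowE in YrXq short_decay exp_bound D_small.
rewrite (IZR_natr 5) in Xd; rewrite (IZR_natr 3) in exp_bound.
rewrite (IZR_natr 2) in D_small.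
apply: (@colorable_of_numerics R n q d (max_edge_degree E) (/ 4096)%R X Y) => //.
- exact: leq_trans n27.
- by apply/RleP; rewrite -R0E; Lra.lra.
- by apply/RleP; rewrite -(IZR_natr 8) -!RmultE -R1E /=; Lra.lra.
all: exact/RleP.
Qed.
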